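(* If $A$ is a factorial ring (unique factorization domain), then every invertible $A$-module is isomorphic to $A$.
   Context: An $A$-module is called invertible if it is projective, finitely generated and of rank $1$. Here a finitely generated $A$-module $L$ has rank $n$ if for every prime ideal $\mathfrak{p}$ of $A$, with $\kappa(\mathfrak{p})$ the fraction field of $A/\mathfrak{p}$, the $\kappa(\mathfrak p)$-vector space $(L/\mathfrak{p}L)_{\mathfrak{p}}=\kappa(\mathfrak{p})\otimes_A L$ has dimension $n$. *)

(* Defs.v *)
From HB Require Import structures.
From mathcomp Require Import all_boot all_algebra.
From mathcomp Require Import ring_quotient generic_quotient fraction boolp.

Set Implicit Arguments.
Unset Strict Implicit.
Unset Printing Implicit Defensive.

Import GRing.Theory.
Local Open Scope ring_scope.
Local Open Scope quotient_scope.

(* The library makes A / p a commutative ring; to apply {fraction _} it has to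
   be an idomainType, whose units are the elements that have an inverse. *)
Definition quot_domain (A : comNzRingType) (p : prime_idealr A) : Type :=
  {ideal_quot p}.

Section QuotDomain.
Variables (A : comNzRingType) (p : prime_idealr A).

HB.instance Definition _ := GRing.ComNzRing.on (quot_domain p).

Definition quot_unit : pred (quot_domain p) := fun x => `[< exists y, y * x = 1 >].

Definition quot_inv (x : quot_domain p) : quot_domain p :=
  if pselect (exists y, y * x = 1) is left h then projT1 (cid h) else x.

Fact quot_mulVx : {in quot_unit, left_inverse 1 quot_inv *%R}.
Proof.
move=> x /asboolP ux; rewrite /quot_inv; case: pselect => // h.
by case: (cid h).
Qed.

Fact quot_unitPl (x y : quot_domain p) : y * x = 1 -> quot_unit x.
Proof. by move=> yx; apply/asboolP; exists y. Qed.

Fact quot_inv_out : {in [predC quot_unit], quot_inv =1 id}.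
Proof. by move=> x /asboolP nux; rewrite /quot_inv; case: pselect. Qed.

HB.instance Definition _ := GRing.ComNzRing_hasMulInverse.Build (quot_domain p)
  quot_mulVx quot_unitPl quot_inv_out.

Fact quot_mulf_eq0 : GRing.integral_domain_axiom (quot_domain p).
Proof. exact: Quotient.rquot_IdomainAxiom. Qed.

HB.instance Definition _ :=
  GRing.ComUnitRing_isIntegral.Build (quot_domain p) quot_mulf_eq0.

Definition quot_proj (a : A) : quot_domain p := \pi_{ideal_quot p} a.

Fact quot_proj_is_zmod_morphism : zmod_morphism quot_proj.
Proof. exact: (rmorphB (\pi_{ideal_quot p} : {rmorphism A -> {ideal_quot p}})). Qed.
HB.instance Definition _ := GRing.isZmodMorphism.Build A (quot_domain p)
  quot_proj quot_proj_is_zmod_morphism.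

Fact quot_proj_is_monoid_morphism : monoid_morphism quot_proj.
Proof. exact: pi_is_monoid_morphism. Qed.
HB.instance Definition _ := GRing.isMonoidMorphism.Build A (quot_domain p)
  quot_proj quot_proj_is_monoid_morphism.

Definition residue_field : fieldType := {fraction (quot_domain p)}.

Definition to_residue : {rmorphism A -> residue_field} :=
  @FracField.tofrac (quot_domain p) \o quot_proj.

End QuotDomain.

(* The tensor product S (x)_A L, where S is an A-algebra through phi. A list
   [:: (s1, x1); ...; (sn, xn)] stands for s1 (x) x1 + ... + sn (x) xn. *)
Section BaseChange.
Variables (A S : comNzRingType) (phi : {rmorphism A -> S}) (L : lmodType A).
Implicit Types (a b : S) (x y : L) (s t u v : seq (S * L)).

(* The constructors present the quotient of the free commutative monoid on
   S * L by the bilinearity relations. That monoid is a group because (- s) (x) x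
   is opposite to s (x) x; tensor0l is not implied by the other relations. *)
Inductive tensor_eqv : seq (S * L) -> seq (S * L) -> Prop :=
| tensor_refl s : tensor_eqv s s
| tensor_sym s t : tensor_eqv s t -> tensor_eqv t s
| tensor_trans s t u : tensor_eqv s t -> tensor_eqv t u -> tensor_eqv s u
| tensor_cat s t u v :
    tensor_eqv s t -> tensor_eqv u v -> tensor_eqv (s ++ u) (t ++ v)
| tensor_catC s t : tensor_eqv (s ++ t) (t ++ s)
| tensor0l x : tensor_eqv [:: (0, x)] [::]
| tensorDl a b x : tensor_eqv [:: (a + b, x)] [:: (a, x); (b, x)]
| tensorDr a x y : tensor_eqv [:: (a, x + y)] [:: (a, x); (a, y)]
| tensorZ a (c : A) x : tensor_eqv [:: (a * phi c, x)] [:: (a, c *: x)].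

Definition tensor_rel s t : bool := `[< tensor_eqv s t >].

Fact tensor_rel_refl : reflexive tensor_rel.
Proof. by move=> s; apply/asboolP; apply: tensor_refl. Qed.

Fact tensor_rel_sym : symmetric tensor_rel.
Proof. by move=> s t; apply/asboolP/asboolP => /tensor_sym. Qed.

Fact tensor_rel_trans : transitive tensor_rel.
Proof.
by move=> t s u /asboolP st /asboolP tu; apply/asboolP; apply: tensor_trans tu.
Qed.

Canonical tensor_equiv :=
  EquivRel tensor_rel tensor_rel_refl tensor_rel_sym tensor_rel_trans.

Definition base_change : Type := {eq_quot tensor_equiv}.

HB.instance Definition _ := Choice.on base_change.
HB.instance Definition _ : EqQuotient _ tensor_rel base_change :=
  EqQuotient.on base_change.

Fact base_change_eq s t :
  tensor_eqv s t <-> \pi_base_change s = \pi_base_change t.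
Proof.
by split=> [st|/eqmodP/asboolP//]; apply/eqmodP/asboolP.
Qed.

Definition tensor_scale a s : seq (S * L) := [seq (a * q.1, q.2) | q <- s].

Fact tensor_scale_eqv a s t :
  tensor_eqv s t -> tensor_eqv (tensor_scale a s) (tensor_scale a t).
Proof.
elim=> {s t} [s|s t _|s t u _ st _ tu|s t u v _ st _ uv|s t|x|b c x|b x y|b c x].
- exact: tensor_refl.
- exact: tensor_sym.
- exact: tensor_trans tu.
- by rewrite /tensor_scale !map_cat; apply: tensor_cat.
- by rewrite /tensor_scale !map_cat; apply: tensor_catC.
- by rewrite /= mulr0; apply: tensor0l.
- by rewrite /= mulrDr; apply: tensorDl.
- exact: tensorDr.
- by rewrite /= mulrA; apply: tensorZ.
Qed.

Definition tensor_add (X Y : base_change) : base_change :=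
  \pi_base_change (repr X ++ repr Y).
Definition tensor_smul a (X : base_change) : base_change :=
  \pi_base_change (tensor_scale a (repr X)).

Fact base_change_repr s : tensor_eqv (repr (\pi_base_change s)) s.
Proof. by rewrite base_change_eq reprK. Qed.

Fact tensor_addE s t :
  tensor_add (\pi_base_change s) (\pi_base_change t) = \pi_base_change (s ++ t).
Proof. by rewrite -base_change_eq; apply: tensor_cat; apply: base_change_repr. Qed.

Fact tensor_smulE a s :
  tensor_smul a (\pi_base_change s) = \pi_base_change (tensor_scale a s).
Proof. by rewrite -base_change_eq; apply/tensor_scale_eqv/base_change_repr. Qed.

Fact tensor_addA : associative tensor_add.
Proof.
elim/quotW=> s; elim/quotW=> t; elim/quotW=> u.
by rewrite (tensor_addE t u) (tensor_addE s t) !tensor_addE catA.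
Qed.

Fact tensor_addC : commutative tensor_add.
Proof. by move=> X Y; rewrite -base_change_eq; apply: tensor_catC. Qed.

Fact tensor_add0 : left_id (\pi_base_change [::]) tensor_add.
Proof. by elim/quotW=> s; rewrite tensor_addE. Qed.

Fact tensor_scaleDl a b s :
  tensor_eqv (tensor_scale (a + b) s) (tensor_scale a s ++ tensor_scale b s).
Proof.
elim: s => [|[c x] s IHs] /=; first exact: tensor_refl.
rewrite mulrDl -cat1s.
apply: tensor_trans (tensor_cat (tensorDl _ _ _) IHs) _.
rewrite -[X in tensor_eqv X _]/([:: (a * c, x)] ++
  ([:: (b * c, x)] ++ tensor_scale a s) ++ tensor_scale b s).
rewrite -[X in tensor_eqv _ X]/([:: (a * c, x)] ++
  (tensor_scale a s ++ ([:: (b * c, x)] ++ tensor_scale b s))).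
apply: tensor_cat; first exact: tensor_refl.
rewrite [X in tensor_eqv _ X]catA; apply: tensor_cat; last exact: tensor_refl.
exact: tensor_catC.
Qed.

Fact tensor_scale0 s : tensor_eqv (tensor_scale 0 s) [::].
Proof.
elim: s => [|[c x] s IHs] /=; first exact: tensor_refl.
by rewrite mul0r -cat1s; apply: (@tensor_cat _ [::] _ [::]) => //; apply: tensor0l.
Qed.

Fact tensor_scale1 s : tensor_scale 1 s = s.
Proof. by elim: s => //= -[c x] s ->; rewrite mul1r. Qed.

Fact tensor_addN :
  left_inverse (\pi_base_change [::]) (tensor_smul (- 1)) tensor_add.
Proof.
elim/quotW=> s; rewrite tensor_smulE tensor_addE -base_change_eq.
rewrite -[X in _ ++ X]tensor_scale1.
apply: tensor_trans (tensor_sym (tensor_scaleDl _ _ _)) _.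
by rewrite addNr; apply: tensor_scale0.
Qed.

HB.instance Definition _ := GRing.isZmodule.Build base_change
  tensor_addA tensor_addC tensor_add0 tensor_addN.

Fact tensor_smulA a b (X : base_change) :
  tensor_smul a (tensor_smul b X) = tensor_smul (a * b) X.
Proof.
elim/quotW: X => s; rewrite (tensor_smulE b s) !tensor_smulE; congr (\pi _).
rewrite /tensor_scale -map_comp; apply: eq_map => q /=.
by rewrite mulrA.
Qed.

Fact tensor_smul1 : left_id 1 tensor_smul.
Proof. by elim/quotW=> s; rewrite tensor_smulE tensor_scale1. Qed.

Fact tensor_smulDr : right_distributive tensor_smul +%R.
Proof.
move=> a; elim/quotW=> s; elim/quotW=> t.
rewrite -[_ + _ in LHS]/(tensor_add _ _) -[RHS]/(tensor_add _ _).
rewrite (tensor_addE s t) !tensor_smulE.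
rewrite [RHS]tensor_addE; congr (\pi _); exact: map_cat.
Qed.

Fact tensor_smulDl (X : base_change) : {morph tensor_smul^~ X : a b / a + b}.
Proof.
move=> a b; elim/quotW: X => s.
rewrite -[RHS]/(tensor_add _ _) !tensor_smulE [RHS]tensor_addE.
by rewrite -base_change_eq; apply: tensor_scaleDl.
Qed.

HB.instance Definition _ := GRing.Zmodule_isLmodule.Build S base_change
  tensor_smulA tensor_smul1 tensor_smulDr tensor_smulDl.

End BaseChange.

Section Modules.
Variables (A : comNzRingType) (L : lmodType A).

Definition finitely_generated : Prop :=
  exists (n : nat) (e : 'I_n -> L),
    forall x, exists c : 'I_n -> A, x = \sum_i c i *: e i.

Definition projective : Prop :=
  forall (M N : lmodType A) (g : {linear M -> N}) (f : {linear L -> N}),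
    (forall y, exists x, g x = y) -> exists h : {linear L -> M}, g \o h =1 f.

Definition has_rank (n : nat) : Prop :=
  forall p : prime_idealr A,
    inhabited (Vector.axiom n (base_change (to_residue p) L)).

Definition invertible : Prop :=
  [/\ projective, finitely_generated & has_rank 1].

End Modules.

Section Factorial.
Variable A : idomainType.
Implicit Types (a b c u : A) (s t : seq A).

Definition irreducible a : Prop :=
  [/\ a != 0, a \isn't a GRing.unit &
    forall b c, a = b * c -> b \is a GRing.unit \/ c \is a GRing.unit].

Definition associated a b : Prop := exists2 u, u \is a GRing.unit & b = u * a.

Definition factorial_ring : Prop :=
  (forall a, a != 0 ->
     exists s, {in s, forall q, irreducible q} /\ associated (\prod_(q <- s) q) a)
  /\
  (forall s t, {in s, forall q, irreducible q} ->
     {in t, forall q, irreducible q} ->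
     associated (\prod_(q <- s) q) (\prod_(q <- t) q) ->
     exists t', [/\ perm_eq t' t, size t' = size s &
       forall i, (i < size s)%N -> associated s`_i t'`_i]).

End Factorial.

(* Main.v *)
(* Let (e_i), (phi_i) be a dual basis of L. After base change to Frac A the
   module L becomes a line, so phi_i(x) phi_j(y) = phi_i(y) phi_j(x); thus only
   the rank at the zero prime matters. Fix x0 with phi_k(x0) <> 0, let d be a gcd
   of the phi_j(x0), and write phi_j(x0) = d v_j. Since
   phi_k(x0) | phi_k(x) phi_j(x0) for all j, also phi_k(x0) | phi_k(x) d, whence
   phi_j(x) = c(x) v_j for a linear form c. It is injective because the phi_j
   separate points, and x0 = d (sum_i v_i e_i) gives c(sum_i v_i e_i) = 1. *)
Require Import Defs.
From mathcomp Require Import all_boot all_algebra.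
From mathcomp Require Import ring_quotient generic_quotient fraction boolp ring.
From HB Require Import structures.

Set Implicit Arguments.
Unset Strict Implicit.
Unset Printing Implicit Defensive.

Import GRing.Theory.
Local Open Scope ring_scope.
Local Open Scope quotient_scope.

(** * Dual bases of projective modules *)

Lemma ex_linear (A : comNzRingType) (L M : lmodType A) (f : L -> M) :
  linear f -> exists g : {linear L -> M}, g =1 f.
Proof.
move=> lf; pose g : {linear L -> M} :=
  HB.pack f (GRing.isLinear.Build A L M *:%R f lf).
by exists g.
Qed.

(** Generators give a surjection from ['rV[A]_n] onto [L]. Projectivity splits it, and the [phi i]
    are the coordinates of the section. *)
Lemma dual_basis (A : comNzRingType) (L : lmodType A) :
  projective L -> finitely_generated L ->
  exists (n : nat) (e : 'I_n -> L) (phi : 'I_n -> {linear L -> A^o}),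
    forall x, x = \sum_i phi i x *: e i.
Proof.
move=> prL [n [e genL]].
have lg : linear (fun c : 'rV[A]_n => \sum_i c 0 i *: e i).
  move=> a c d; rewrite scaler_sumr -big_split /=; apply: eq_bigr => i _.
  by rewrite !mxE scalerDl scalerA.
have [g gE] := ex_linear lg.
have lid : linear (@id L) by [].
have [f fE] := ex_linear lid.
have [|h hK] := prL _ _ g f.
  move=> x; have [c ->] := genL x; exists (\row_i c i).
  by rewrite gE; apply: eq_bigr => i _; rewrite mxE.
have lphi i : linear (fun x => h x 0 i : A^o).
  by move=> a x y; rewrite linearP !mxE.
exists n, e, (fun i => projT1 (cid (ex_linear (lphi i)))) => x.
rewrite -[LHS]fE -hK /= gE; apply: eq_bigr => i _.
by case: (cid _) => phi /= ->.
Qed.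

(** * Rank one at the zero prime *)

Section BaseChangeFunctional.
Variables (A S : comNzRingType) (phi : {rmorphism A -> S}) (L : lmodType A).
Variable f : {linear L -> A^o}.

Local Notation ev s := (\sum_(q <- s) q.1 * phi (f q.2)).

Lemma tensor_eqv_eval (s t : seq (S * L)) : tensor_eqv phi s t -> ev s = ev t.
Proof.
elim=> {s t} [//|//|s t u _ st _ tu|s t u v _ st _ uv|s t|x|b c x|b x y|b c x].
- by rewrite st.
- by rewrite !big_cat st uv.
- by rewrite !big_cat /= addrC.
- by rewrite big_seq1 big_nil mul0r.
- by rewrite !big_cons !big_nil !addr0 mulrDl.
- by rewrite !big_cons !big_nil !addr0 /= linearD rmorphD mulrDr.
- by rewrite !big_seq1 /= linearZ rmorphM mulrA.
Qed.

(** [F] is the extension of scalars of [f], evaluated on representatives; this is sound because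
    evaluation respects the tensor relations. *)
Lemma base_change_functional :
  exists F : base_change phi L -> S,
    (forall a X, F (a *: X) = a * F X) /\
    (forall x, F (\pi_(base_change phi L) [:: (1, x)]) = phi (f x)).
Proof.
exists (fun X => ev (repr X)); split=> [a|x]; last first.
  by rewrite (tensor_eqv_eval (base_change_repr _ _)) big_seq1 mul1r.
elim/quotW=> s; rewrite -[_ *: _]/(tensor_smul _ _) tensor_smulE.
rewrite !(tensor_eqv_eval (base_change_repr _ _)) big_map mulr_sumr.
by apply: eq_bigr => q _; rewrite mulrA.
Qed.

End BaseChangeFunctional.

Section ZeroIdeal.
Variable A : idomainType.

Definition zero_ideal : {pred A} := pred1 0.

Fact zero_ideal_closed : idealr_closed zero_ideal.
Proof.
split=> [||a u v /eqP-> /eqP->]; rewrite ?inE ?oner_eq0 //.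
by rewrite mulr0 addr0.
Qed.

Fact zero_ideal_prime : prime_idealr_closed zero_ideal.
Proof. by move=> u v; rewrite !inE mulf_eq0. Qed.

HB.instance Definition _ := isIdealr.Build A zero_ideal zero_ideal_closed.
HB.instance Definition _ := isPrimeIdealrClosed.Build A zero_ideal zero_ideal_prime.

Definition zero_prime : prime_idealr A := zero_ideal.

Lemma to_residue_inj : injective (to_residue zero_prime).
Proof.
move=> a b /eqP; rewrite /= tofrac_eq => /eqP eab.
apply/eqP; rewrite -subr_eq0.
have := Quotient.idealrBE zero_prime a b.
rewrite /quot_proj in eab; rewrite eab eqxx.
by rewrite inE.
Qed.

End ZeroIdeal.

(** Over the residue field at 0, the tensors of [x] and [y] are multiples of the single vector
    [w 1], so the extended functionals satisfy the identity; it descends because [A] embeds in that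
    field. *)
Lemma rank1_functionals (A : idomainType) (L : lmodType A) :
  has_rank L 1 -> forall (f g : {linear L -> A^o}) x y, f x * g y = f y * g x.
Proof.
move=> /(_ (zero_prime A)) [[v lv [w vK wK]]] f g x y.
set res := to_residue (zero_prime A) in v lv w vK wK.
have gen X : X = v X 0 0 *: w 1.
  apply: (can_inj vK); rewrite -[_ *: w 1]addr0 lv wK.
  (* Linearity at -1 yields [v 0 = 0]. *)
  have := lv (-1) (w 1) (w 1); rewrite !scaleN1r !addNr => ->.
  by rewrite addr0; apply/matrixP => i j; rewrite !ord1 !mxE mulr1.
have [F [FZ FE]] := base_change_functional res f.
have [G [GZ GE]] := base_change_functional res g.
apply: (@to_residue_inj A); rewrite -/res !rmorphM -!FE -!GE.
rewrite (gen (\pi [:: (1, x)])) (gen (\pi [:: (1, y)])) !FZ !GZ.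
by rewrite mulrACA [RHS]mulrACA [X in X * _ = _]mulrC.
Qed.

Lemma rank1_nontrivial (A : idomainType) (L : lmodType A) :
  has_rank L 1 -> exists x : L, x != 0.
Proof.
move=> /(_ (zero_prime A)) [[v lv [w vK wK]]].
apply: contrapT => /forallNP L0.
have {}L0 (x : L) : x = 0 by apply: contra_notP (L0 x) => /eqP.
set res := to_residue (zero_prime A) in v lv w vK wK.
have T0 (X : base_change res L) : X = \pi [::].
  elim/quotW: X => s; apply/(base_change_eq res).
  elim: s => [|[a x] s IHs]; first exact: tensor_refl.
  rewrite -cat1s; apply: (@tensor_cat _ _ _ _ _ [::] _ [::]) => //.
  (* Writing the zero vector as [0 *: 0] lets the scalar 0 cross the tensor sign. *)
  rewrite (L0 x) -(scale0r 0); apply: tensor_trans (tensor_sym (tensorZ _ _ _ _)) _.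
  by rewrite rmorph0 mulr0; apply: tensor0l.
have : w 1 = w 0 by rewrite (T0 (w 1)) (T0 (w 0)).
move=> /(can_inj wK) /matrixP /(_ 0 0); rewrite !mxE => /eqP.
exact/negP/oner_neq0.
Qed.

(** * Divisibility in factorial rings *)

Section Factorial.
Variable A : idomainType.
Implicit Types a b p q : A.

Definition divides a b := exists c, b = a * c.

Lemma divides_factor u v p q s a :
  a = v * \prod_(q <- s) q -> p \in s -> p = u * q -> divides q a.
Proof.
move=> -> ps pE; rewrite (big_rem p) //= pE.
by eexists; rewrite mulrCA -!mulrA mulrCA.
Qed.

(** Uniqueness compares [q] followed by the factors of the cofactor [z] with the joined factors of
    [a] and [b]: an associate of [q] occurs among the latter. *)
Lemma irreducible_prime (hA : factorial_ring A) q a b :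
  irreducible q -> divides q (a * b) -> divides q a \/ divides q b.
Proof.
case: hA => fac uniq irr_q [z abE].
have [->|a0] := eqVneq a 0; first by left; exists 0; rewrite mulr0.
have [->|b0] := eqVneq b 0; first by right; exists 0; rewrite mulr0.
have z0 : z != 0.
  by apply: contraTneq (mulf_neq0 a0 b0) => z0; rewrite abE z0 mulr0 eqxx.
have [s [irr_s [u uu aE]]] := fac a a0.
have [t [irr_t [v uv bE]]] := fac b b0.
have [r [irr_r [w uw zE]]] := fac z z0.
have [||| t' [pt' st' at']] := uniq (q :: r) (s ++ t).
- by move=> x; rewrite inE => /predU1P[->|/irr_r].
- by move=> x; rewrite mem_cat => /orP[/irr_s|/irr_t].
- have uuv : u * v \is a GRing.unit by rewrite unitrM uu uv.
  exists ((u * v)^-1 * w); first by rewrite unitrM unitrV uuv.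
  rewrite big_cons big_cat /=; apply: (mulrI uuv).
  by rewrite -[_^-1 * w * _]mulrA mulVKr // mulrACA -aE -bE abE zE mulrCA.
have [u' uu' qE] := at' 0%N isT.
have : t'`_0 \in s ++ t by rewrite -(perm_mem pt') mem_nth // st'.
by rewrite mem_cat => /orP[ins|int]; [left|right];
  apply: divides_factor qE; eassumption.
Qed.

(** Here [d] is a gcd of [a] and all [r i]: for a common divisor [e], the last clause with
    [p = a / e] gives that [e] divides [d]. Induction on the factors of [a]: a factor [q] dividing
    every [r i] goes into [d]; otherwise [q], being prime, divides every admissible [p]. *)
Lemma common_divisor (hA : factorial_ring A) (I : Type) (r : I -> A) a :
  a != 0 ->
  exists d, [/\ divides d a, forall i, divides d (r i) &
    forall p, (forall i, divides a (p * r i)) -> divides a (p * d)].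
Proof.
move=> a0; have [s [irr_s [u uu ->]]] := hA.1 a a0.
elim: s r irr_s {a0} => [|q s IHs] r irr_s.
  rewrite big_nil mulr1; exists 1; split=> [|i|p _].
  - by exists u; rewrite mul1r.
  - by exists (r i); rewrite mul1r.
  - by exists (u^-1 * (p * 1)); rewrite mulVKr.
have irr_q : irreducible q by apply: irr_s; rewrite mem_head.
have {}irr_s : {in s, forall x, irreducible x}.
  by move=> x xs; apply: irr_s; rewrite inE xs orbT.
have q0 : q != 0 by case: irr_q.
rewrite big_cons mulrCA; move: (u * _) IHs => b IHs.
have [qr|] := pselect (forall i, divides q (r i)).
  pose r' i := projT1 (cid (qr i)).
  have rE i : r i = q * r' i by rewrite /r'; case: (cid _).
  have [d [[c bE] dr dP]] := IHs r' irr_s.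
  exists (q * d); split=> [|i|p pr].
  - by exists c; rewrite bE mulrA.
  - by have [e r'E] := dr i; exists e; rewrite rE r'E mulrA.
  - have [i|e pdE] := dP p; last by exists e; rewrite mulrCA pdE mulrA.
    have [e] := pr i; rewrite rE mulrCA -mulrA => /(mulfI q0) ->.
    by exists e.
move=> /existsNP[i nqri].
have [d [[c bE] dr dP]] := IHs r irr_s.
exists d; split=> // [|p pr]; first by exists (q * c); rewrite bE mulrCA.
have [p' pE] : divides q p.
  have [|//|/nqri//] := @irreducible_prime hA q p (r i) irr_q.
  by have [e ->] := pr i; exists (b * e); rewrite mulrA.
have [j|e pdE] := dP p'; last by exists e; rewrite pE -!mulrA pdE.
by have [e] := pr j; rewrite pE -!mulrA => /(mulfI q0) ->; exists e.
Qed.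

End Factorial.

Theorem mainTheorem7 (A : idomainType) (hA : factorial_ring A)
    (L : lmodType A) (hL : invertible L) :
  exists f : {linear L -> A^o}, bijective f.
Proof.
case: hL => prL fgL rkL.
have minor := rank1_functionals rkL.
have [x0 x0_neq0] := rank1_nontrivial rkL.
have [n [e [phi phiE]]] := dual_basis prL fgL.
have phi_inj x y : (forall i, phi i x = phi i y) -> x = y.
  by move=> exy; rewrite (phiE x) (phiE y); apply: eq_bigr => i _; rewrite exy.
have [k phik0] : exists k, phi k x0 != 0.
  apply: contrapT => /forallNP phi0; case/eqP: x0_neq0; apply: phi_inj => i.
  by rewrite linear0; apply: contra_notP (phi0 i) => /eqP.
have [d [_ dr dP]] := common_divisor hA (fun i => phi i x0) phik0.
pose v i := projT1 (cid (dr i)).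
have vE i : phi i x0 = d * v i by rewrite /v; case: (cid _).
have /andP[d0 vk0] : (d != 0) && (v k != 0) by rewrite -negb_or -mulf_eq0 -vE.
have quot x : exists c, forall j, phi j x = c * v j.
  have [j|c] := dP (phi k x).
    by exists (phi j x); apply: minor.
  rewrite vE -mulrA mulrC => /(mulfI d0) phikx; exists c => j.
  (* The identity carries the formula from [k] to every [j], after cancelling [d * v k]. *)
  have := minor (phi j) (phi k) x x0; rewrite phikx !vE => E.
  apply: (mulIf (mulf_neq0 d0 vk0)); rewrite E; ring.
pose c x := projT1 (cid (quot x)).
have cE j x : phi j x = c x * v j by rewrite /c; case: (cid _).
(* As [v k] is nonzero, the chosen [c x] is determined by [phi k x]; this makes [c] linear. *)
have c_uniq x b : phi k x = b * v k -> c x = b.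
  by rewrite cE => /(mulIf vk0).
have lc : linear (c : L -> A^o).
  by move=> a x y; apply: c_uniq; rewrite linearP !cE mulrDl -mulrA.
have [f fE] := ex_linear lc.
pose z := \sum_i v i *: e i.
have x0E : x0 = d *: z.
  rewrite [LHS]phiE scaler_sumr; apply: eq_bigr => i _.
  by rewrite vE scalerA.
have fz : f z = 1.
  apply: (mulfI d0); rewrite mulr1 -[LHS]linearZ -x0E fE.
  exact: c_uniq.
have fbz (b : A) : f (b *: z) = b by rewrite linearZ fz; exact: mulr1.
exists f, (fun b => b *: z) => // x.
(* Every [phi i] factors through [c], and [f] agrees on [x] and [f x *: z]. *)
by apply: phi_inj => i; rewrite !cE -!fE fbz.
Qed.
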